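(* Consider the cellular model described in the context. Then the $L$-localizability probability satisfies $$\mathtt{P_L}\le \sum_{\omega=0}^{\chi}\left(1-\left(\frac{\gamma}{\beta}-(\omega-1)\right)^{-2/\alpha}\right)^{\omega} f_\Omega(\omega),\qquad \chi=\min\{L-1,\lfloor \gamma/\beta\rfloor\},$$ with the convention $0^0=1$. (In particular the bound does not depend on $\lambda$, $q$, $P$ or $\sigma^2$.)
   Context: Model: Let $\Phi$ be a homogeneous Poisson point process on $\mathbb{R}^2$ of intensity $\lambda>0$ (base station (BS) locations, shadowing assumed already absorbed into $\Phi$); the user is at the origin $o$. Label the points of $\Phi$ in increasing distance from $o$ as $x_1,x_2,\dots$ and let $R_k=\|x_k\|$. Fix an integer $L\ge 1$, a path-loss exponent $\alpha>2$, transmit power $P>0$, noise power $\sigma^2\ge0$, processing gain $\gamma>0$, threshold $\beta>0$, and $p,q\in[0,1]$. Independently of $\Phi$ and of each other, let $a_1,\dots,a_L$ be Bernoulli($p$) and $b_{L+1},b_{L+2},\dots$ be Bernoulli($q$) random variables. For $k\in\{1,\dots,L\}$ define $$\mathsf{SINR}_k(L)=\frac{P\|x_k\|^{-\alpha}}{\sum_{i=1,i\ne k}^{L}a_iP\|x_i\|^{-\alpha}+\sum_{j=L+1}^\infty b_jP\|x_j\|^{-\alpha}+\sigma^2}.$$ Let $\Omega=\sum_{i=1}^{L-1}a_i$, with pmf $f_\Omega(\omega)=\binom{L-1}{\omega}p^\omega(1-p)^{L-1-\omega}$, $\omega\in\{0,\dots,L-1\}$. The $L$-localizability probability is $\mathtt{P_L}=\mathbb{E}\left[\prod_{k=1}^L\mathbb{1}\left(\mathsf{SINR}_k(L)\ge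 \beta/\gamma\right)\right]$. *)

(* Defs.v *)
From HB Require Import structures.
From mathcomp Require Import all_boot all_order all_algebra.
From mathcomp Require Import all_classical all_reals all_analysis.
Set Implicit Arguments. Unset Strict Implicit. Unset Printing Implicit Defensive.
Import Order.TTheory GRing.Theory Num.Theory.
Local Open Scope classical_set_scope.
Local Open Scope ring_scope.

(* Conventions:  the plane R^2 is modelled as R * R with the
   product Borel sigma-algebra and the Lebesgue measure leb2; BS locations are
   indexed from 0 (paper index k corresponds to index k-1 here). *)

Section defs.
Variable R : realType.

Definition enorm2 (x : R * R) : R := Num.sqrt (x.1 ^+ 2 + x.2 ^+ 2).

Definition leb2 : set (R * R) -> \bar R :=
  (@lebesgue_measure R \x @lebesgue_measure R)%E.

(* Poisson pmf with mean mu >= 0 (convention 0^0 = 1, so the mean-0 law is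
   the Dirac mass at 0) *)
Definition pois_pmf (mu : R) (m : nat) : R := mu ^+ m / (m`!)%:R * expR (- mu).

Definition bern_pmf (p : R) (s : bool) : R := if s then p else 1 - p.

Variables (d : measure_display) (T : measurableType d).

Definition count_eq (x : nat -> T -> R * R) (A : set (R * R)) (m : nat) : set T :=
  [set w | exists s : seq nat, [/\ uniq s, size s = m &
                                  forall k, A (x k w) <-> k \in s]].

Definition is_ordered_hPPP (P : probability T R) (lam : R)
  (x : nat -> T -> R * R) : Prop :=
  (forall k, measurable_fun setT (x k)) /\
  (forall k w, enorm2 (x k w) <= enorm2 (x k.+1 w)) /\
  (forall (n : nat) (A : 'I_n -> set (R * R)) (m : 'I_n -> nat),
      (forall i, measurable (A i)) ->
      (forall i, (leb2 (A i) < +oo)%E) ->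
      (forall i j, i != j -> A i `&` A j = set0) ->
      P (\bigcap_(i in [set: 'I_n]) count_eq x (A i) (m i)) =
      (\prod_(i < n) pois_pmf (lam * fine (leb2 (A i))) (m i))%:E).

Definition pl (alpha : R) (x : nat -> T -> R * R) (k : nat) (w : T) : R :=
  enorm2 (x k w) `^ (- alpha).

(* the event SINR_k(L) >= thr, written without division:
   Pw R_k^-alpha >= thr * (sum_{i<L, i<>k} a_i Pw R_i^-alpha
                         + sum_{j>=L} b_j Pw R_j^-alpha + sigma2)
   (interference is an extended real, the series having nonnegative terms) *)
Definition SINR_ge (L : nat) (alpha Pw sigma2 thr : R) (x : nat -> T -> R * R)
  (a b : nat -> T -> bool) (k : nat) : set T :=
  [set w | (thr%:E * ((\sum_(i < L | i != k :> nat)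
                         ((a i w)%:R * Pw * pl alpha x i w))%:E
                      + (\sum_(L <= j <oo) ((b j w)%:R * Pw * pl alpha x j w)%:E)
                      + sigma2%:E)
            <= (Pw * pl alpha x k w)%:E)%E].

(* joint law of the marks: a_0..a_{L-1} iid Bernoulli(p), b_L, b_{L+1}, ...
   iid Bernoulli(q), all independent of each other and of the point process
   (tested on finite-dimensional cylinder events of the process). *)
Definition marks_law (P : probability T R) (L : nat) (p q : R)
  (x : nat -> T -> R * R) (a b : nat -> T -> bool) : Prop :=
  (forall i, measurable [set w | a i w]) /\
  (forall j, measurable [set w | b j w]) /\
  (forall (n M : nat) (B : nat -> set (R * R)) (sa sb : nat -> bool),
      (forall k, measurable (B k)) ->
      let E := [set w | forall k, (k < n)%N -> B k (x k w)] in
      P (E `&` [set w | forall i, (i < L)%N -> a i w = sa i]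
           `&` [set w | forall j, (L <= j < L + M)%N -> b j w = sb j]) =
      (P E * (\prod_(i < L) bern_pmf p (sa i)
              * \prod_(L <= j < L + M) bern_pmf q (sb j))%:E)%E).

End defs.

(* Main.v *)
Require Import Defs.
From HB Require Import structures.
From mathcomp Require Import all_boot all_order all_algebra.
From mathcomp Require Import all_classical all_reals all_analysis.
From mathcomp Require Import measurable_realfun zify ring lra.
Import Order.TTheory GRing.Theory Num.Theory.
Local Open Scope classical_set_scope.
Local Open Scope ring_scope.

Set Implicit Arguments.
Unset Strict Implicit.
Unset Printing Implicit Defensive.

(* Only the constraint of the farthest served station is needed.  Dropping the
   noise and the outer interference, it forces
     \sum_(i active) R_i^-alpha <= (gamma / beta) R_L^-alpha,
   and as every active term is at least R_L^-alpha, the om active stations all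
   satisfy R_i >= c R_L with c = (gamma / beta - (om - 1))^(-1/alpha).  Given
   R_L, the L - 1 nearer points are uniform in the disc of radius R_L, and each
   of them is beyond c R_L with probability 1 - c^2.

   To avoid conditioning on R_L, the plane is cut into annuli of equal area,
   each of Poisson mean eta.  On the event that a disc of the subdivision
   contains L - 1 points and the next annulus exactly one, the above estimate
   is an exact identity between Poisson weights.  Since the points are ordered,
   such count events are cylinder events of (x_k), hence independent of the
   marks.  Their total probability tends to 1 as eta tends to 0, by comparison
   with a negative binomial law. *)

(** * Planar Lebesgue measure of discs *)

(** Packs a scaled pushforward as a genuine measure, so that the uniqueness theorems for Lebesgue
    and product measures can be applied to it. *)
Lemma scaled_preimage_measure d1 d2 (T1 : measurableType d1) (T2 : measurableType d2)
  (R : realType) (m : {measure set T1 -> \bar R}) (f : T1 -> T2) (k : R) :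
  0 <= k -> measurable_fun [set: T1] f ->
  exists m' : {measure set T2 -> \bar R}, forall A, m' A = (k%:E * m (f @^-1` A))%E.
Proof.
move=> k0 mf; pose m1 :=
  HB.pack_for {measure set T2 -> \bar R} (pushforward m f)
    (Measure.on (pushforward m f)).
by exists (mscale (NngNum k0) (m1 mf)).
Qed.

(** By uniqueness: [c] times the pushforward under multiplication by [c] agrees with Lebesgue
    measure on half-open intervals. *)
Lemma lebesgue_measure_scale (R : realType) (c : R) (A : set R) :
  0 < c -> measurable A ->
  (lebesgue_measure ((fun t => c * t)%R @^-1` A) = c^-1%:E * lebesgue_measure A)%E.
Proof.
move=> c0 mA; have mc : measurable_fun [set: R] ( *%R c) by exact: mulrl_measurable.
have [m mE] := @scaled_preimage_measure _ _ (measurableTypeR R) (measurableTypeR R) R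
  lebesgue_measure ( *%R c) c (ltW c0) mc.
have -> : lebesgue_measure A = m A.
  apply: lebesgue_measure_unique => // _ [[u v]] _ <-.
  rewrite mE.
  have -> : *%R c @^-1` `]u, v] = `]u / c, v / c]%classic.
    by apply/seteqP; split => t /=; rewrite !in_itv/= ltr_pdivrMr// ler_pdivlMr// mulrC.
  rewrite (lebesgue_measure_itv `]u, v])/=.
  rewrite (_ : lebesgue_measure _ = lebesgue_measure `](u / c), (v / c)]%classic)//.
  rewrite (lebesgue_measure_itv `](u / c), (v / c)])/= !lte_fin ltr_pM2r ?invr_gt0//.
  case: ifP => _; last by rewrite mule0.
  by rewrite -!EFinD -EFinM; congr _%:E; field; rewrite gt_eqF.
rewrite mE /leb2 muleA -EFinM mulVf ?mul1e//.
by rewrite gt_eqF.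
Qed.

Lemma leb2X (R : realType) (U V : set R) : measurable U -> measurable V ->
  leb2 (U `*` V) = (lebesgue_measure U * lebesgue_measure V)%E.
Proof. exact: (@product_measure1E _ _ (measurableTypeR R) (measurableTypeR R)). Qed.

Lemma le_leb2 (R : realType) (A B : set (R * R)) : measurable A -> measurable B ->
  A `<=` B -> (leb2 A <= leb2 B)%E.
Proof.
move=> mA mB.
by apply: (@le_measure _ _ _ (@lebesgue_measure R \x @lebesgue_measure R)%E); rewrite inE.
Qed.

Lemma leb2D (R : realType) (A B : set (R * R)) : measurable A -> measurable B ->
  A `<=` B -> leb2 A \is a fin_num -> (leb2 (B `\` A) = leb2 B - leb2 A)%E.
Proof.
move=> mA mB AB finA.
rewrite -[in leb2 B](setUIDK B A) (setIidr AB).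
rewrite {2}/leb2 measureU//; [|exact: measurableD|by rewrite setDE setICA setICr setI0].
by rewrite addeAC subee// add0e.
Qed.

Lemma leb2_set0 (R : realType) : leb2 (set0 : set (R * R)) = 0%E.
Proof. exact: (@measure0 _ _ _ (@lebesgue_measure R \x @lebesgue_measure R)%E). Qed.

(** The same uniqueness argument, now on rectangles, where each coordinate contributes a factor
    [c]. *)
Lemma leb2_scale (R : realType) (c : R) (A : set (R * R)) :
  0 < c -> measurable A ->
  (leb2 ((fun z => (c * z.1, c * z.2))%R @^-1` A) = (c ^- 2)%:E * leb2 A)%E.
Proof.
pose RR : measurableType _ := (measurableTypeR R * measurableTypeR R)%type.
move=> c0 mA.
have mc : measurable_fun [set: R * R] (fun z : R * R => (c * z.1, c * z.2)).
  apply/measurable_fun_pairP; split => /=.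
    exact: (measurableT_comp (mulrl_measurable c) measurable_fst).
  exact: (measurableT_comp (mulrl_measurable c) measurable_snd).
have [m mE] := @scaled_preimage_measure _ _ RR RR R (lebesgue_measure \x lebesgue_measure)%E
  (fun z : R * R => (c * z.1, c * z.2)) (c ^+ 2) (exprn_ge0 2 (ltW c0)) mc.
have {}mE (B : set (R * R)) : m B =
  ((c ^+ 2)%:E * leb2 ((fun z => (c * z.1, c * z.2))%R @^-1` B))%E by exact: mE.
have -> : leb2 A = m A.
  apply: (@product_measure_unique _ _ (measurableTypeR R) (measurableTypeR R) R
    lebesgue_measure lebesgue_measure m) => // U V mU mV.
  rewrite mE.
  have -> : (fun z : R * R => (c * z.1, c * z.2)) @^-1` (U `*` V) =
    ( *%R c @^-1` U) `*` ( *%R c @^-1` V) by [].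
  rewrite leb2X; last 2 first.
  - by rewrite -[X in measurable X]setTI; exact: (mulrl_measurable c).
  - by rewrite -[X in measurable X]setTI; exact: (mulrl_measurable c).
  rewrite !lebesgue_measure_scale// muleACA !muleA -!EFinM.
  by rewrite (_ : c ^+ 2 * c^-1 * c^-1 = 1) ?mul1e//; field; rewrite gt_eqF.
rewrite mE /leb2 muleA -EFinM mulVf ?mul1e//.
by rewrite expf_neq0// gt_eqF.
Qed.

Lemma enorm2_ge0 (R : realType) (z : R * R) : 0 <= enorm2 z.
Proof. exact: sqrtr_ge0. Qed.

Lemma measurable_enorm2 (R : realType) : measurable_fun [set: R * R] (@enorm2 R).
Proof.
apply: (measurableT_comp (continuous_measurable_fun (@sqrt_continuous R))).
by apply: measurable_funD; apply: measurable_funX;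
  [exact: measurable_fst|exact: measurable_snd].
Qed.

(** Open discs make [disc 0] empty and turn differences of discs into half-open annuli, so that
    successive annuli are disjoint and leave no gap. *)
Definition disc {R : realType} (r : R) : set (R * R) := [set z | enorm2 z < r].

Lemma measurable_disc (R : realType) (r : R) : measurable (disc r).
Proof.
rewrite [X in measurable X](_ : _ = @enorm2 R @^-1` `]-oo, r[).
  by rewrite -[X in measurable X]setTI; exact: measurable_enorm2.
by apply/seteqP; split => z /=; rewrite /disc/= in_itv.
Qed.

(** The constant [kap] is the measure of the unit disc. An inscribed square shows it positive, a
    circumscribed one finite, and scaling gives the other radii. *)
Lemma leb2_disc (R : realType) :
  exists2 kap : R, 0 < kap & forall r, 0 <= r -> leb2 (disc r) = (kap * r ^+ 2)%:E.
Proof.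
have mu1 : (leb2 (disc (1 : R)%R) <= 4%R%:E)%E.
  pose Q : set (R * R) := `[-1, 1] `*` `[-1, 1].
  apply: (@le_trans _ _ (leb2 Q)).
    apply: le_leb2; [exact: measurable_disc|exact: measurableX|].
    move=> -[u v]; rewrite /disc /enorm2/= => h.
    have : u ^+ 2 + v ^+ 2 < 1.
      rewrite -[X in X < _]sqr_sqrtr ?addr_ge0 ?sqr_ge0//.
      by rewrite -[ltRHS](expr1n _ 2) ltr_pXn2r// nnegrE ?sqrtr_ge0.
    by move=> {}h; split; rewrite /= in_itv/= -ler_norml -(@ler_pXn2r _ 2)// ?nnegrE//
      real_normK ?num_real// expr1n; have := sqr_ge0 u; have := sqr_ge0 v; lra.
  rewrite leb2X// !lebesgue_measure_itv/= lte_fin.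
  by rewrite ifT; [rewrite -!EFinD -EFinM lee_fin; lra|lra].
have mu0 : (0 < leb2 (disc (1 : R)%R))%E.
  pose Q : set (R * R) := `[-(1/2), 1/2] `*` `[-(1/2), 1/2].
  apply: (@lt_le_trans _ _ (leb2 Q)).
    rewrite leb2X// !lebesgue_measure_itv/= lte_fin.
    by rewrite ifT; [rewrite -!EFinD -EFinM lte_fin; lra|lra].
  apply: le_leb2; [exact: measurableX|exact: measurable_disc|].
  move=> -[u v] [/=]; rewrite !in_itv/= => /andP[u1 u2] /andP[v1 v2].
  rewrite /disc /enorm2/= -sqrtr1 ltr_sqrt//; nra.
have fin1 : leb2 (disc (1 : R)) \is a fin_num.
  by rewrite ge0_fin_numE ?(ltW mu0)//; apply: le_lt_trans mu1 _; rewrite ltry.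
exists (fine (leb2 (disc (1 : R)))).
  by rewrite -lte_fin fineK.
move=> r; rewrite le_eqVlt => /predU1P[<-|r0].
  rewrite expr0n/= mulr0 (_ : disc 0 = set0) ?leb2_set0//.
  by apply/seteqP; split => // z; rewrite /disc/= ltNge enorm2_ge0.
have -> : disc r = (fun z : R * R => (r^-1 * z.1, r^-1 * z.2)) @^-1` disc (1 : R).
  apply/seteqP; split => z; rewrite /disc /enorm2/= !exprMn -mulrDr;
    rewrite sqrtrM ?sqr_ge0// sqrtr_sqr ger0_norm ?invr_ge0 ?ltW//;
    by rewrite mulrC ltr_pdivrMr// mul1r.
rewrite leb2_scale ?invr_gt0//; last exact: measurable_disc.
by rewrite EFinM fineK// exprVn invrK muleC.
Qed.

(** * Total mass of the Poisson cells *)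

(** In Bernoulli trials of success probability [u], at most n successes in J trials splits into at
    most n in J+1 trials, or success number n+1 at trial J+1. *)
Lemma binomial_tail_step (R : comNzRingType) (u z : R) (n J : nat) : u + z = 1 ->
  \sum_(m < n.+1) 'C(J.+1, m)%:R * u ^+ m * z ^+ (J.+1 - m) +
    u ^+ n.+1 * ('C(J, n)%:R * z ^+ (J - n)) =
  \sum_(m < n.+1) 'C(J, m)%:R * u ^+ m * z ^+ (J - m).
Proof.
move=> uz; have zS m : 'C(J, m)%:R * z ^+ (J.+1 - m) = z * ('C(J, m)%:R * z ^+ (J - m)).
  have [mJ|mJ] := leqP m J; last by rewrite bin_small// !mul0r mulr0.
  by rewrite subSn// exprS mulrCA.
elim: n => [|n IH].
  rewrite !big_ord_recl !big_ord0/= !bin0 !subn0 !expr0 !addr0 !expr1 exprS !mul1r.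
  by rewrite -mulrDl (addrC z) uz mul1r.
rewrite big_ord_recr/= [in RHS]big_ord_recr/= -IH -!addrA; congr (_ + _).
rewrite binS natrD subSS mulrDl mulrDl.
rewrite ['C(J, n.+1)%:R * _ * _ in LHS]mulrAC; have := zS n.+1; rewrite subSS => ->.
have -> : 'C(J, n.+1)%:R * u ^+ n.+1 * z ^+ (J - n.+1) =
  (u + z) * (u ^+ n.+1 * ('C(J, n.+1)%:R * z ^+ (J - n.+1))) by rewrite uz; ring.
by rewrite !exprS; ring.
Qed.

(** Telescoping of the previous identity: success number n+1 comes within J trials unless these
    contain at most n successes. *)
Lemma negative_binomial_sum (R : comNzRingType) (u z : R) (n J : nat) : u + z = 1 ->
  u ^+ n.+1 * \sum_(j < J) 'C(j, n)%:R * z ^+ (j - n) =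
  1 - \sum_(m < n.+1) 'C(J, m)%:R * u ^+ m * z ^+ (J - m).
Proof.
move=> uz; elim: J => [|J IH].
  rewrite big_ord0 mulr0 big_ord_recl/= bin0 big1 ?addr0 ?expr0 ?mulr1 ?subrr//.
  by move=> i _; rewrite bin0n/= !mul0r.
rewrite big_ord_recr/= mulrDr IH -(binomial_tail_step n J uz); ring.
Qed.

(** For fixed m, the partial sums over J of the m-th term are bounded by the negative binomial
    identity, so the term tends to 0; the tail is a finite sum of such terms. *)
Lemma binomial_tail_cvg (R : realType) (u z : R) (n : nat) :
  0 < u -> 0 < z -> u + z = 1 ->
  \sum_(m < n.+1) 'C(J, m)%:R * u ^+ m * z ^+ (J - m) @[J --> \oo] --> 0.
Proof.
move=> u0 z0 uz.
have term_cvg m : 'C(J, m)%:R * z ^+ (J - m) @[J --> \oo] --> 0.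
  apply: cvg_series_cvg_0; apply: nondecreasing_is_cvgn.
    apply/nondecreasing_seqP => k; rewrite /series/= big_nat_recr//= lerDl.
    by rewrite mulr_ge0// exprn_ge0// ltW.
  exists (u ^- m.+1) => _ [k _ <-]; rewrite /series/= big_mkord.
  rewrite -[leRHS]mulr1 -ler_pdivrMl ?invr_gt0 ?exprn_gt0// invrK.
  rewrite negative_binomial_sum// gerBl sumr_ge0// => i _.
  by rewrite !mulr_ge0// exprn_ge0// ltW.
pose tail k J := \sum_(m < k) 'C(J, m)%:R * u ^+ m * z ^+ (J - m).
suff : forall k, tail k J @[J --> \oo] --> 0 by apply.
elim=> [|k IH].
  by rewrite /tail; under eq_fun do rewrite big_ord0; exact: cvg_cst.
have -> : tail k.+1 = tail k \+ (fun J => u ^+ k * ('C(J, k)%:R * z ^+ (J - k))).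
  by apply/funext => J; rewrite /tail big_ord_recr/= -mulrA mulrCA.
rewrite -[X in _ --> X](addr0 0) -[X in _ --> _ + X](mulr0 (u ^+ k)).
exact: cvgD IH (cvgMl_tmp (term_cvg k)).
Qed.

(** Here [1 - z] is the probability that an annulus of mean [eta] is nonempty. The comparison rests
    on [1 - z <= eta] and C(j,n) <= j^n / n!, and the factor [z ^+ n.+1] balances the
    exponentials. *)
Lemma bin_le_pois (R : realType) (eta z : R) (n j : nat) : 0 < eta -> z = expR (- eta) ->
  z ^+ n.+1 * ((1 - z) ^+ n.+1 * ('C(j, n)%:R * z ^+ (j - n))) <=
  pois_pmf (j%:R * eta) n * pois_pmf eta 1.
Proof.
move=> eta0 zE; have z0 : 0 < z by rewrite zE expR_gt0.
have z1 : z <= 1 by rewrite zE -expR0 ler_expR; lra.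
have u_eta : 1 - z <= eta by have := expR_ge1Dx (- eta); rewrite -zE; lra.
have pois_ge0 : 0 <= pois_pmf (j%:R * eta) n * pois_pmf eta 1.
  by rewrite /pois_pmf !mulr_ge0 ?invr_ge0 ?expR_ge0 ?exprn_ge0 ?mulr_ge0// ltW.
have [nj|jn] := leqP n j; last by rewrite bin_small// mul0r !mulr0.
have -> : pois_pmf (j%:R * eta) n * pois_pmf eta 1 =
    eta ^+ n.+1 * (j%:R ^+ n / n`!%:R * z ^+ j.+1).
  rewrite /pois_pmf exprMn expr1 (_ : 1`!%:R = 1 :> R)// divr1 -mulrN expRM_natl -zE !exprS; ring.
have -> : z ^+ n.+1 * ((1 - z) ^+ n.+1 * ('C(j, n)%:R * z ^+ (j - n))) =
    (1 - z) ^+ n.+1 * ('C(j, n)%:R * z ^+ j.+1).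
  by rewrite -(subnKC nj) addKn -addSn exprD; ring.
apply: ler_pM.
- by rewrite exprn_ge0// subr_ge0.
- by rewrite mulr_ge0// exprn_ge0// ltW.
- by rewrite lerXn2r// nnegrE ?subr_ge0// ltW.
rewrite ler_pM2r ?exprn_gt0// ler_pdivlMr ?ltr0n ?fact_gt0//.
rewrite -natrM bin_ffact -natrX ler_nat.
rewrite ffact_prod -[X in (_ <= _ ^ X)%N]card_ord -prod_nat_const.
by apply: leq_prod => i _; exact: leq_subr.
Qed.

(** Half of [e] pays for the factor lost in the comparison with the negative binomial law, the other
    half for its tail beyond J. *)
Lemma pois_cells_sum_ge (R : realType) (n : nat) (e : R) : 0 < e ->
  exists2 eta : R, 0 < eta &
    exists J, 1 - e <= \sum_(j < J) pois_pmf (j%:R * eta) n * pois_pmf eta 1.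
Proof.
(* This makes (n+1) eta = e/2, hence z^(n+1) = exp(-e/2) >= 1 - e/2. *)
move=> e0; pose eta := e / 2 / n.+1%:R; have eta0 : 0 < eta by rewrite !divr_gt0.
exists eta => //; pose z := expR (- eta); pose u := 1 - z.
have z0 : 0 < z by exact: expR_gt0.
have u0 : 0 < u by rewrite subr_gt0 -expR0 ltr_expR; lra.
have uz : u + z = 1 by rewrite subrK.
have zn : 1 - e / 2 <= z ^+ n.+1.
  rewrite -expRM_natl; apply: le_trans (expR_ge1Dx _).
  by rewrite mulrN [_ * eta]mulrC /eta divfK// pnatr_eq0.
pose tail J := \sum_(m < n.+1) 'C(J, m)%:R * u ^+ m * z ^+ (J - m).
have [J tailJ] : exists J, tail J < e / 2.
  have /cvgr_lt/(_ (e / 2)) := binomial_tail_cvg n u0 z0 uz.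
  by rewrite divr_gt0// => /(_ isT)[J _ /(_ J (leqnn J))]; exists J.
exists J; apply: (@le_trans _ _ (z ^+ n.+1 * (1 - tail J))).
  have tail0 : 0 <= tail J.
    by apply: sumr_ge0 => m _; rewrite !mulr_ge0// exprn_ge0// ltW.
  have z1 : z ^+ n.+1 <= 1 by rewrite exprn_ile1 ?(ltW z0)//; lra.
  by have := ler_wpM2r tail0 z1; lra.
rewrite -negative_binomial_sum// !mulr_sumr; apply: ler_sum => j _.
exact: bin_le_pois.
Qed.

(** * Thinning, marks and path loss *)

(** Both sides count the ordered pairs of disjoint subsets, of sizes m and w, of a set of n
    elements. *)
Lemma bin_mulC (n m w : nat) : ('C(n, m) * 'C(n - m, w) = 'C(n, w) * 'C(n - w, m))%N.
Proof.
have [mwn|nmw] := leqP (m + w) n; last first.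
  have zero (k l : nat) : (n < k + l)%N -> ('C(n, k) * 'C(n - k, l) = 0)%N.
    move=> nkl; have [nk|kn] := ltnP n k; first by rewrite bin_small.
    by rewrite ['C(n - k, l)]bin_small ?muln0//; lia.
  by rewrite !zero// addnC.
have f0 : (0 < m`! * w`! * (n - m - w)`!)%N by rewrite !muln_gt0 !fact_gt0.
apply/eqP; rewrite -(eqn_pmul2r f0); apply/eqP.
have En : ('C(n, m) * (m`! * (n - m)`!) = n`!)%N by rewrite bin_fact//; lia.
have Enm : ('C(n - m, w) * (w`! * (n - m - w)`!) = (n - m)`!)%N by rewrite bin_fact//; lia.
have Ew : ('C(n, w) * (w`! * (n - w)`!) = n`!)%N by rewrite bin_fact//; lia.
have Ewm : ('C(n - w, m) * (m`! * (n - w - m)`!) = (n - w)`!)%N by rewrite bin_fact//; lia.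
transitivity n`!; first by rewrite -En -Enm; ring.
by rewrite -Ew -Ewm subnAC; ring.
Qed.

(** Let a disc of mean [mu] contain an inner disc with a fraction [t] of its area. Both sides are
    the expected number of w-subsets lying outside the inner disc, on the event of n points in all:
    the left sums over the number m of inner points, the right uses that given n points each is
    outside with probability 1 - t. *)
Lemma pois_thinning (R : realType) (mu t : R) (n w : nat) :
  \sum_(m < n.+1) 'C(n - m, w)%:R *
    (pois_pmf (mu * t) m * pois_pmf (mu * (1 - t)) (n - m)) =
  'C(n, w)%:R * (1 - t) ^+ w * pois_pmf mu n.
Proof.
have [wn|nw] := leqP w n; last first.
  rewrite bin_small// !mul0r big1// => m _; rewrite bin_small ?mul0r//.
  exact: leq_ltn_trans (leq_subr _ _) nw.
have fact_neq0 k : k`!%:R != 0 :> R by rewrite pnatr_eq0 -lt0n fact_gt0.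
(* Multiply by 1 = (1 - t + t)^(n - w) and expand; the terms added up to index n have a vanishing
   binomial coefficient. *)
have -> : (1 - t) ^+ w = \sum_(m < n.+1) 'C(n - w, m)%:R * (t ^+ m * (1 - t) ^+ (n - m)).
  transitivity ((1 - t) ^+ w * (1 - t + t) ^+ (n - w)); first by rewrite subrK expr1n mulr1.
  rewrite [(1 - t + t) ^+ _]exprDn mulr_sumr (big_ord_widen n.+1 (fun i => (1 - t) ^+ w *
    ((1 - t) ^+ (n - w - i) * t ^+ i *+ 'C(n - w, i)))) ?ltnS ?leq_subr//.
  rewrite big_mkcond; apply: eq_bigr => m _; rewrite ltnS; case: ifPn => mnw.
    rewrite -mulr_natl (_ : (n - m = w + (n - w - m))%N) ?exprD; last by lia.
    by ring.
  by rewrite bin_small ?mul0r//; lia.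
rewrite mulr_sumr mulr_suml; apply: eq_bigr => m _.
have mn : (m <= n)%N by rewrite -ltnS.
have -> : 'C(n - m, w)%:R = 'C(n, w)%:R * 'C(n - w, m)%:R / 'C(n, m)%:R :> R.
  by rewrite -natrM -bin_mulC natrM mulrC mulrA mulVf ?mul1r// pnatr_eq0 -lt0n bin_gt0.
have -> : pois_pmf mu n = mu ^+ m * mu ^+ (n - m) / ('C(n, m)%:R * (m`!%:R * (n - m)`!%:R))
    * (expR (- (mu * t)) * expR (- (mu * (1 - t)))).
  rewrite /pois_pmf -exprD subnKC// -!natrM bin_fact// -expRD; congr (_ * expR _); ring.
have Cnm : 'C(n, m)%:R != 0 :> R by rewrite pnatr_eq0 -lt0n bin_gt0.
by rewrite /pois_pmf !exprMn; field; rewrite Cnm !fact_neq0.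
Qed.

Lemma prod_bern_pmf (R : realType) (p : R) (n : nat) (S : {set 'I_n}) :
  \prod_(i < n) bern_pmf p (i \in S) = p ^+ #|S| * (1 - p) ^+ (n - #|S|).
Proof.
rewrite (bigID (mem S))/=; congr (_ * _).
  by rewrite (eq_bigr (fun=> p)) ?prodr_const// => i ->.
rewrite (eq_bigr (fun=> 1 - p)) => [|i /negbTE ->//].
by rewrite prodr_const -[X in (X - _)%N](card_ord n) -(cardC (mem S)) addKn.
Qed.

(** When the m nearest stations lie in the inner disc, these are the possible sets of w active
    stations outside it; their number is the coefficient in [pois_thinning]. *)
Lemma card_late_subsets (n m w : nat) : (m <= n)%N ->
  #|[set S : {set 'I_n} | S \subset [set i : 'I_n | (m <= i)%N] & #|S| == w]%SET| =
  'C(n - m, w).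
Proof.
move=> mn; rewrite cards_draws; congr 'C(_, w).
have card_early : #|[set i : 'I_n | (i < m)%N]%SET| = m.
  by rewrite -sum1dep_card -(big_ord_widen n (fun=> 1%N))// sum1_card card_ord.
have := cardsC [set i : 'I_n | (i < m)%N]%SET; rewrite card_early card_ord.
rewrite (_ : (~: _)%SET = [set i : 'I_n | (m <= i)%N]%SET); first exact: canRL (addKn m).
by apply/setP => i; rewrite !inE -leqNgt.
Qed.

(** Each term of the sum is at least that of n, which bounds the cardinality. Keeping the term of i
    and bounding the others this way leaves rho_i^-alpha <= K rho_n^-alpha with K >= 1, and the
    decreasing power can be inverted. *)
Lemma path_loss_far (R : realType) (alpha g : R) (n : nat) (rho : nat -> R) (S : {set 'I_n}) :
  0 < alpha -> (forall k, 0 < rho k) -> (forall k, rho k <= rho k.+1) ->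
  \sum_(i in S) rho i `^ (- alpha) <= g * rho n `^ (- alpha) ->
  #|S|%:R <= g /\
  (forall i, i \in S -> (g - (#|S|%:R - 1)) `^ (- alpha^-1) * rho n <= rho i).
Proof.
move=> alpha0 rho0 rhoS; set P := rho n `^ (- alpha) => sumS.
have P0 : 0 < P by rewrite powR_gt0.
have rho_le (i : 'I_n) : rho i <= rho n.
  by move/nondecreasing_seqP : rhoS => /(_ i n); apply; exact: ltnW.
have P_le (i : 'I_n) : P <= rho i `^ (- alpha).
  rewrite /P !powRN lef_pV2 ?posrE ?powR_gt0//.
  by apply: ge0_ler_powR; rewrite ?nnegrE ?rho_le ?(ltW (rho0 _)) ?(ltW alpha0).
have Sg : #|S|%:R <= g.
  rewrite -(ler_pM2r P0); apply: le_trans sumS.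
  by rewrite mulr_natl -sumr_const; apply: ler_sum => j _; exact: P_le.
split => // i iS; set K := g - _.
have K1 : 1 <= K by rewrite /K; lra.
have K0 : 0 < K by exact: lt_le_trans K1.
have iK : rho i `^ (- alpha) <= K * P.
  move: sumS; rewrite (bigD1 i)//=.
  have : #|S|.-1%:R * P <= \sum_(j in S | j != i) rho j `^ (- alpha).
    rewrite (cardsD1 i) iS/= mulr_natl -sumr_const.
    rewrite [leRHS](eq_bigl [in (S :\ i)%SET]); first by apply: ler_sum => j _; exact: P_le.
    by move=> j; rewrite !inE andbC.
  rewrite /K -[in #|S|%:R](@prednK #|S|); last by apply/card_gt0P; exists i.
  rewrite -natr1; lra.
have -> : K `^ (- alpha^-1) * rho n = (K * P) `^ (- alpha^-1).
  rewrite powRM ?(ltW K0) ?(ltW P0)// -powRrM mulrNN divff ?gt_eqF//.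
  by rewrite powRr1// ltW.
have -> : rho i = (rho i `^ (- alpha)) `^ (- alpha^-1).
  by rewrite -powRrM mulrNN divff ?gt_eqF// powRr1// ltW.
move: iK; set Q := rho i `^ (- alpha) => QK.
have Q0 : 0 < Q by rewrite powR_gt0.
have KP0 : 0 < K * P by rewrite mulr_gt0.
rewrite !(powRN _ alpha^-1) lef_pV2 ?posrE ?powR_gt0//.
by apply: ge0_ler_powR; rewrite ?nnegrE ?QK ?invr_ge0 ?(ltW alpha0) ?(ltW Q0) ?(ltW KP0).
Qed.

(** * Counting events as cylinder events *)

Lemma nondecreasing_count (R : realType) (rho : nat -> R) (u : R) :
  (forall k, rho k <= rho k.+1) -> (exists k, u <= rho k) ->
  exists N, forall k, (rho k < u) = (k < N)%N.
Proof.
move=> rhoS [N0 N0P].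
have [N NP Nmin] := ex_minnP (ex_intro (fun k => u <= rho k) N0 N0P).
exists N => k; apply/idP/idP => [|kN]; last first.
  by rewrite ltNge; apply: contraL kN => /Nmin; rewrite leqNgt.
apply: contraTT; rewrite -leqNgt -leNgt => Nk; apply: le_trans NP _.
by move/nondecreasing_seqP : rhoS; exact.
Qed.

(** Ordering forces the points below a given radius to form an initial segment of indices. A count
    in an annulus thus becomes a condition on each [x k] separately. *)
Lemma count_eq_shell (R : realType) (d : measure_display) (T : measurableType d)
  (x : nat -> T -> R * R) (r r' : R) (m l : nat) (w : T) :
  (forall k, enorm2 (x k w) <= enorm2 (x k.+1 w)) -> r <= r' ->
  (forall k, (enorm2 (x k w) < r) = (k < m)%N) ->
  count_eq x (disc r' `\` disc r) l w <->
  forall k, (enorm2 (x k w) < r') = (k < m + l)%N.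
Proof.
move=> xS rr' below; split; last first.
  move=> below'; exists (iota m l); rewrite iota_uniq size_iota; split=> // k.
  rewrite mem_iota /disc/= below below' (leqNgt m k).
  by split=> [[-> /negP ->]|/andP[/negP ? ->]].
move=> [s [s_uniq s_size sP]].
have in_s k : (k \in s) = (enorm2 (x k w) < r') && (m <= k)%N.
  apply/idP/andP; first by move=> /sP; rewrite /disc/= below => -[-> /negP]; rewrite -(leqNgt m k).
  by rewrite (leqNgt m k) => -[? /negP ?]; apply/sP; rewrite /disc/= below.
(* If all points were within [r'], those from index m on would all be listed in [s], which has only
   l entries. *)
have outside : exists k, r' <= enorm2 (x k w).
  apply/not_existsP => lt_r'.
  have : (size (iota m l.+1) <= size s)%N.
    apply: uniq_leq_size; first exact: iota_uniq.
    move=> k; rewrite mem_iota in_s => /andP[-> _]; rewrite andbT ltNge.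
    exact/negP/lt_r'.
  by rewrite size_iota s_size ltnn.
have [N below'] := nondecreasing_count xS outside.
have mN : (m <= N)%N.
  rewrite leqNgt; apply/negP; rewrite -below => /lt_le_trans/(_ rr').
  by rewrite below' ltnn.
have -> : (m + l = N)%N => //.
have /perm_size : perm_eq s (iota m (N - m)).
  by apply: uniq_perm; rewrite ?iota_uniq// => k; rewrite mem_iota in_s below' subnKC// andbC.
by rewrite s_size size_iota => ->; rewrite subnKC.
Qed.

(* Indices start at 0, so the event locates R_(n+1) of the paper in [r, r'[. *)
Definition cell {R : realType} {d : measure_display} {T : measurableType d}
  (x : nat -> T -> R * R) (s r r' : R) (m n : nat) : set T :=
  [set w | forall k, [/\ (enorm2 (x k w) < s) = (k < m)%N,
    (enorm2 (x k w) < r) = (k < n)%N & (enorm2 (x k w) < r') = (k < n.+1)%N]].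

(** Puts a cell in the form required by the Poisson axiom. The inner disc is written as a shell
    around the empty [disc 0], so that one lemma treats all three regions. *)
Lemma cell_count_eq (R : realType) (d : measure_display) (T : measurableType d)
  (x : nat -> T -> R * R) (s r r' : R) (m n : nat) :
  (forall k w, enorm2 (x k w) <= enorm2 (x k.+1 w)) ->
  0 <= s -> s <= r -> r <= r' -> (m <= n)%N ->
  cell x s r r' m n = \bigcap_(i in [set: 'I_3]) count_eq x
    (nth set0 [:: disc s `\` disc 0; disc r `\` disc s; disc r' `\` disc r] i)
    (nth 0%N [:: m; (n - m)%N; 1%N] i).
Proof.
move=> xS s0 sr rr' mn; apply/seteqP; split=> w.
  move=> cw; move=> [[|[|[|//]]] ?] _ /=.
  - apply/(@count_eq_shell _ _ _ x 0 s 0) => // k; first by rewrite ltn0 ltNge enorm2_ge0.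
    by have [] := cw k.
  - apply/(@count_eq_shell _ _ _ x s r m) => // k; first by have [] := cw k.
    by have [_ ->] := cw k; rewrite subnKC.
  - apply/(@count_eq_shell _ _ _ x r r' n) => // k; first by have [] := cw k.
    by have [_ _ ->] := cw k; rewrite addn1.
move=> cw.
have c0 k : (enorm2 (x k w) < s) = (k < m)%N.
  apply: (@count_eq_shell _ _ _ x 0 s 0 m w (xS^~ w) s0 _).1; last exact: (cw (@Ordinal 3 0 isT) I).
  by move=> {}k; rewrite ltn0 ltNge enorm2_ge0.
have c1 k : (enorm2 (x k w) < r) = (k < n)%N.
  rewrite -(subnKC mn).
  exact: (@count_eq_shell _ _ _ x s r m (n - m) w (xS^~ w) sr c0).1 (cw (@Ordinal 3 1 isT) I) k.
move=> k; split=> //; rewrite -(addn1 n).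
exact: (@count_eq_shell _ _ _ x r r' n 1 w (xS^~ w) rr' c1).1 (cw (@Ordinal 3 2 isT) I) k.
Qed.

Lemma measurable_cell (R : realType) (d : measure_display) (T : measurableType d)
  (x : nat -> T -> R * R) (s r r' : R) (m n : nat) :
  (forall k, measurable_fun setT (x k)) -> measurable (cell x s r r' m n).
Proof.
move=> mx.
have mlt u k (b : bool) : measurable [set w | (enorm2 (x k w) < u) = b].
  have mu : measurable [set w | enorm2 (x k w) < u].
    by rewrite -[X in measurable X]setTI; exact: (mx k measurableT _ (measurable_disc u)).
  case: b => //; rewrite [X in measurable X](_ : _ = ~` [set w | enorm2 (x k w) < u]).
    exact: measurableC.
  by apply/seteqP; split=> v /= => [->//|/negP/negbTE].
rewrite [X in measurable X](_ : _ = \bigcap_k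
  ([set w | (enorm2 (x k w) < s) = (k < m)%N] `&`
   [set w | (enorm2 (x k w) < r) = (k < n)%N] `&`
   [set w | (enorm2 (x k w) < r') = (k < n.+1)%N])).
  by apply: bigcapT_measurable => k; apply: measurableI => //; exact: measurableI.
apply/seteqP; split=> w cw k; first by move=> _; have [] := cw k.
by have [[? ?] ?] := cw k I.
Qed.

Lemma measurable_shell (R : realType) (r r' : R) : measurable (disc r' `\` disc r).
Proof. by apply: measurableD; exact: measurable_disc. Qed.

Lemma leb2_shell (R : realType) (kap r r' : R) :
  (forall r, 0 <= r -> leb2 (disc r) = (kap * r ^+ 2)%:E) -> 0 <= r -> r <= r' ->
  leb2 (disc r' `\` disc r) = (kap * (r' ^+ 2 - r ^+ 2))%:E.
Proof.
move=> kapE r0 rr'; have r'0 := le_trans r0 rr'.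
rewrite leb2D ?kapE//; try exact: measurable_disc.
- by rewrite -EFinB mulrBr.
- by move=> z; rewrite /disc/= => /lt_le_trans; apply.
Qed.

Lemma probability_cell (R : realType) (d : measure_display) (T : measurableType d)
  (P : probability T R) (lam kap : R) (x : nat -> T -> R * R) (s r r' : R) (m n : nat) :
  is_ordered_hPPP P lam x ->
  (forall r, 0 <= r -> leb2 (disc r) = (kap * r ^+ 2)%:E) ->
  0 <= s -> s <= r -> r <= r' -> (m <= n)%N ->
  P (cell x s r r' m n) =
    (pois_pmf (lam * (kap * s ^+ 2)) m * pois_pmf (lam * (kap * (r ^+ 2 - s ^+ 2))) (n - m)
     * pois_pmf (lam * (kap * (r' ^+ 2 - r ^+ 2))) 1)%:E.
Proof.
move=> [_ [xS xP]] kapE s0 sr rr' mn; have r0 := le_trans s0 sr.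
rewrite cell_count_eq// xP.
- by rewrite !big_ord_recl big_ord0 mulr1 mulrA/= !(leb2_shell kapE)//= expr0n subr0.
- by move=> [[|[|[|//]]] ?] /=; exact: measurable_shell.
- by move=> [[|[|[|//]]] ?] /=; rewrite (leb2_shell kapE)// ltry.
have dis (u v t t' : R) : v <= t -> (disc v `\` disc u) `&` (disc t' `\` disc t) = set0.
  move=> vt; apply/seteqP; split=> // z; rewrite /disc/= => -[[zv _] [_]]; apply.
  exact: lt_le_trans vt.
by move=> [[|[|[|//]]] ?] [[|[|[|//]]] ?] //= _; do 1?[exact: dis];
  rewrite setIC; apply: dis => //; exact: le_trans rr'.
Qed.

(** [marks_law] prescribes all n+1 inner marks, while S concerns only the first n. The event is
    split along the mark of station n, whose two weights add up to 1. *)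
Lemma probability_cell_marks (R : realType) (d : measure_display) (T : measurableType d)
  (P : probability T R) (p q : R) (x : nat -> T -> R * R) (a b : nat -> T -> bool)
  (s r r' : R) (m n : nat) (S : {set 'I_n}) :
  (forall k, measurable_fun setT (x k)) ->
  (forall k w, enorm2 (x k w) <= enorm2 (x k.+1 w)) ->
  s <= r -> r <= r' -> (m <= n)%N ->
  marks_law P n.+1 p q x a b ->
  (P (cell x s r r' m n `&` [set w | forall i : 'I_n, a i w = (i \in S)]) <=
   P (cell x s r r' m n) * (\prod_(i < n) bern_pmf p (i \in S))%:E)%E.
Proof.
move=> mx xS sr rr' mn [ma [_ marks]].
pose B k : set (R * R) := [set z | [/\ (enorm2 z < s) = (k < m)%N,
  (enorm2 z < r) = (k < n)%N & (enorm2 z < r') = (k < n.+1)%N]].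
have mB k : measurable (B k).
  have mlt u (c : bool) : measurable [set z : R * R | (enorm2 z < u) = c].
    case: c; first exact: measurable_disc.
    rewrite [X in measurable X](_ : _ = ~` disc u); first by apply: measurableC; exact: measurable_disc.
    by apply/seteqP; split=> v /= => [|/negP/negbTE]; rewrite /disc/= => ->.
  rewrite [X in measurable X](_ : _ = [set z | (enorm2 z < s) = (k < m)%N] `&`
    [set z | (enorm2 z < r) = (k < n)%N] `&` [set z | (enorm2 z < r') = (k < n.+1)%N]).
    by apply: measurableI => //; exact: measurableI.
  by apply/seteqP; split=> z => [[]|[[]]].
(* Point n+1 is already beyond [r'], and so are all later ones by ordering: the first n+2 points
   decide the cell, a finite cylinder event. *)
have cellE : cell x s r r' m n = [set w | forall k, (k < n.+2)%N -> B k (x k w)].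
  apply/seteqP; split=> w cw k //=; first by move=> _; exact: cw.
  have [kn|nk] := ltnP k n.+2; first exact: cw.
  have [_ _] := cw n.+1 (ltnSn _); rewrite ltnn => /negbT; rewrite -leNgt => r'n.
  have r'k : r' <= enorm2 (x k w).
    by apply: le_trans r'n _; move/nondecreasing_seqP : (xS^~ w); apply; exact: ltnW.
  by rewrite !ltNge r'k (le_trans rr' r'k) (le_trans sr (le_trans rr' r'k))/=; split; lia.
(* In the range i <= n, the default [t] is reached only at index n. *)
pose sa t i := if insub i is Some j then (j : 'I_n) \in S else t.
have saS t (i : 'I_n) : sa t i = (i \in S) by rewrite /sa valK.
have san t : sa t n = t by rewrite /sa insubF// ltnn.
pose F t := cell x s r r' m n `&` [set w | forall i, (i < n.+1)%N -> a i w = sa t i].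
have PF t : P (F t) = (P (cell x s r r' m n) *
    (\prod_(i < n) bern_pmf p (i \in S) * bern_pmf p t)%:E)%E.
  have := marks n.+2 0%N B (sa t) xpred0 mB; cbv zeta.
  rewrite addn0 [X in P (_ `&` X)](_ : _ = setT) ?setIT; last first.
    by apply/seteqP; split=> // w _ j /andP[/leq_ltn_trans h /h]; rewrite ltnn.
  rewrite (big_geq (leqnn _)) mulr1 -cellE -/(F t) => ->.
  rewrite big_ord_recr/= san; congr (_ * (_ * _)%:E)%E.
  by apply: eq_bigr => i _; rewrite saS.
have mF t : measurable (F t).
  apply: measurableI; first exact: measurable_cell.
  rewrite [X in measurable X](_ : _ = \bigcap_(i in [set i | (i < n.+1)%N])
    [set w | a i w = sa t i])//.
  apply: bigcap_measurable => [|i _]; [by exists 0%N | case: (sa t i); first exact: ma].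
  rewrite [X in measurable X](_ : _ = ~` [set w | a i w]); first exact: measurableC.
  by apply/seteqP; split=> w /= => [->//|/negP/negbTE].
have -> : cell x s r r' m n `&` [set w | forall i : 'I_n, a i w = (i \in S)] =
    F true `|` F false.
  apply/seteqP; split=> w; last first.
    by move=> [] [cw aw]; split=> // i; rewrite aw ?saS// ltnS ltnW.
  move=> [cw aw]; suff Fw : F (a n w) w by case: (a n w) Fw; [left|right].
  split=> // i; rewrite ltnS leq_eqVlt => /predU1P[->|ilt]; first by rewrite san.
  by rewrite (aw (Ordinal ilt)) -(saS (a n w) (Ordinal ilt)).
apply: (@le_trans _ _ (P (F true) + P (F false))%E); first exact: measureU2.
rewrite !PF -(@fineK _ (P (cell _ _ _ _ _ _))) ?fin_num_measure//; last exact: measurable_cell.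
by rewrite -!EFinM -EFinD lee_fin /bern_pmf; lra.
Qed.

(** * The SINR event *)

Lemma measurable_pl (R : realType) (d : measure_display) (T : measurableType d)
  (alpha : R) (x : nat -> T -> R * R) (k : nat) :
  measurable_fun setT (x k) -> measurable_fun setT (pl alpha x k).
Proof.
move=> mx; apply: (measurableT_comp (measurable_powR (- alpha))).
exact: measurableT_comp (@measurable_enorm2 R) mx.
Qed.

Lemma measurable_SINR_ge (R : realType) (d : measure_display) (T : measurableType d)
  (L : nat) (alpha Pw sigma2 thr : R) (x : nat -> T -> R * R)
  (a b : nat -> T -> bool) (k : nat) : 0 <= Pw ->
  (forall k, measurable_fun setT (x k)) ->
  (forall i, measurable [set w | a i w]) -> (forall j, measurable [set w | b j w]) ->
  measurable (SINR_ge L alpha Pw sigma2 thr x a b k).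
Proof.
move=> Pw0 mx ma mb.
have interference (c : nat -> T -> bool) i : measurable [set w | c i w] ->
    measurable_fun setT (fun w => (c i w)%:R * Pw * pl alpha x i w).
  move=> mc; apply: measurable_funM; last exact: measurable_pl.
  apply: measurable_funM => //.
  rewrite (_ : (fun w => _) = \1_[set w | c i w] :> (T -> R)).
    exact: measurable_indic.
  by apply/funext => w; rewrite indicE mem_setE.
rewrite -[X in measurable X]setTI; apply: measurable_lee => //; last first.
  by apply/measurable_EFinP; apply: measurable_funM => //; exact: measurable_pl.
apply: emeasurable_funM => //; apply: emeasurable_funD => //; apply: emeasurable_funD.
  apply/measurable_EFinP; under eq_fun do rewrite big_mkcond.
  by apply: measurable_sum => i; case: (i != k :> nat) => //; exact: interference.
rewrite (_ : (fun w => _) = (fun w => \sum_(j <oo | j \in [pred i | (L <= i)%N])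
    ((b j w)%:R * Pw * pl alpha x j w)%:E)%E); last first.
  by apply/funext => w; rewrite eseries_cond.
apply: ge0_emeasurable_sum => [j w _ _|j _]; last first.
  by apply/measurable_EFinP; exact: interference.
by rewrite lee_fin !mulr_ge0 ?powR_ge0.
Qed.

Lemma SINR_ge_last (R : realType) (d : measure_display) (T : measurableType d)
  (n : nat) (alpha Pw sigma2 gamma beta : R) (x : nat -> T -> R * R)
  (a b : nat -> T -> bool) (w : T) :
  0 < Pw -> 0 <= sigma2 -> 0 < gamma -> 0 < beta ->
  SINR_ge n.+1 alpha Pw sigma2 (beta / gamma) x a b n w ->
  \sum_(i < n | a i w) pl alpha x i w <= gamma / beta * pl alpha x n w.
Proof.
move=> Pw0 sigma0 gamma0 beta0; rewrite /SINR_ge/=.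
set A := \sum_(i < n.+1 | _) _; set B := (\sum_(_ <= _ <oo) _)%E.
have B0 : (0 <= B)%E.
  by apply: nneseries_ge0 => j _ _; rewrite lee_fin !mulr_ge0 ?powR_ge0// ltW.
have thr0 : 0 < beta / gamma by rewrite divr_gt0.
have -> : A = Pw * \sum_(i < n | a i w) pl alpha x i w.
  rewrite /A big_mkcond big_ord_recr/= eqxx addr0 mulr_sumr [RHS]big_mkcond.
  apply: eq_bigr => i _; rewrite ltn_eqF//=.
  by case: (a i w); rewrite ?mul1r ?mul0r.
set S := \sum_(i < n | _) _ => SINR.
have : (((beta / gamma) * (Pw * S))%:E <= (Pw * pl alpha x n w)%:E)%E.
  apply: le_trans SINR; rewrite EFinM; apply: lee_wpmul2l; first by rewrite lee_fin ltW.
  by rewrite -addeA; apply: leeDl; rewrite adde_ge0.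
rewrite lee_fin mulrCA ler_pM2l// mulrC -ler_pdivlMr// invf_div.
by rewrite [X in _ <= X]mulrC.
Qed.

(** * Union bound over annuli, active sets and inner counts *)

Lemma le_probability_bigsetU (R : realType) (d : measure_display) (T : measurableType d)
  (P : probability T R) (I : finType) (Q : pred I) (F : I -> set T) :
  (forall i, measurable (F i)) ->
  (P (\big[setU/set0]_(i | Q i) F i) <= \sum_(i | Q i) P (F i))%E.
Proof.
move=> mF.
suff [] : measurable (\big[setU/set0]_(i | Q i) F i) /\
  (P (\big[setU/set0]_(i | Q i) F i) <= \sum_(i | Q i) P (F i))%E by [].
apply: (big_ind2 (fun A v => measurable A /\ (P A <= v)%E)).
- by rewrite measure0.
- move=> A v B u [mA Av] [mB Bu]; split; first exact: measurableU.
  by apply: (@le_trans _ _ (P A + P B)%E); [exact: measureU2|exact: leeD].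
- by move=> i _; split.
Qed.

(** At the origin the path gain is infinite but [powR] returns 0, so this event must be discarded
    before [path_loss_far] applies. It is null because the count at a set of measure zero is Poisson
    of mean 0. *)
Lemma probability_point_at_origin (R : realType) (d : measure_display)
  (T : measurableType d) (P : probability T R) (lam : R) (x : nat -> T -> R * R) :
  is_ordered_hPPP P lam x ->
  measurable [set w | exists k, enorm2 (x k w) <= 0] /\
  P [set w | exists k, enorm2 (x k w) <= 0] = 0%E.
Proof.
move=> [mx [_ xP]]; pose O : set (R * R) := [set z | enorm2 z <= 0].
have mO : measurable O.
  rewrite [X in measurable X](_ : _ = @enorm2 R @^-1` `]-oo, 0]).
    by rewrite -[X in measurable X]setTI; exact: measurable_enorm2.
  by apply/seteqP; split => z /=; rewrite in_itv.
have O0 : leb2 O = 0%E.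
  rewrite (_ : O = [set 0] `*` [set 0]) ?leb2X// ?lebesgue_measure_set1 ?mule0//.
  apply/seteqP; split => -[u v]; rewrite /O/= /enorm2/=.
    rewrite -[X in _ <= X -> _]sqrtr0 ler_sqrt ?addr_ge0 ?sqr_ge0// => uv.
    have sq0 (t : R) : t ^+ 2 <= 0 -> t = 0.
      by move=> t0; apply/eqP; rewrite -sqrf_eq0 eq_le t0 sqr_ge0.
    by split => /=; apply: sq0; have := sqr_ge0 u; have := sqr_ge0 v; lra.
  by move=> [-> ->]; rewrite expr0n addr0 sqrtr0.
set Z := [set w | _].
have mZ : measurable Z.
  rewrite [X in measurable X](_ : _ = \bigcup_k (x k @^-1` O)).
    apply: bigcupT_measurable => k; rewrite -[X in measurable X]setTI.
    exact: mx.
  by apply/seteqP; split=> w [k]; exists k.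
split=> //.
have PZC : P (~` Z) = 1%E.
  have := xP 1%N (fun=> O) (fun=> 0%N) (fun=> mO).
  rewrite big_ord1 O0/= mulr0 /pois_pmf expr0 oppr0 expR0 mulr1 divr1.
  rewrite (_ : \bigcap_(i in _) _ = ~` Z) => [->//|].
  - by move=> i j; rewrite !ord1 eqxx.
  apply/seteqP; split=> w; last first.
    by move=> Zw i _; exists [::]; split=> // k; split=> // Ok; case: Zw; exists k.
  move=> /(_ ord0 I) [s [_ /size0nil -> sP]] [k] /=.
  by move=> xk0; have /sP := xk0 : O (x k w).
have := probability_setC P mZ; rewrite PZC.
rewrite -(@fineK _ (P Z)) ?fin_num_measure// -EFinB => -[] /eqP.
by rewrite eq_sym subr_eq addrC -subr_eq subrr eq_sym => /eqP ->.
Qed.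

Lemma in_bigsetU (T : Type) (I : finType) (Q : pred I) (F : I -> set T) (t : T) :
  (\big[setU/set0]_(i | Q i) F i) t <-> exists2 i, Q i & F i t.
Proof.
split=> [|[i Qi Fi]]; last by rewrite (bigD1 i)//; left.
elim/big_rec: _ => [//|i A Qi IH [Fi|/IH//]]; by exists i.
Qed.

(** Groups the sets S by cardinality v and exchanges the sums: each pair (v, m) then occurs once per
    late subset, which prepares the use of [pois_thinning]. *)
Lemma sum_late_subsets (R : realType) (n chi : nat) (p : R) (f : nat -> nat -> R) :
  \sum_(S : {set 'I_n} | (#|S| <= chi)%N)
    \sum_(m < n.+1 | S \subset [set i : 'I_n | (m <= i)%N]%SET)
      f #|S| m * (p ^+ #|S| * (1 - p) ^+ (n - #|S|)) =
  \sum_(v < chi.+1) p ^+ v * (1 - p) ^+ (n - v) *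
    \sum_(m < n.+1) 'C(n - m, v)%:R * f v m.
Proof.
rewrite (partition_big (fun S : {set 'I_n} => inord #|S| : 'I_chi.+1) xpredT)//=.
apply: eq_bigr => v _.
transitivity (\sum_(S : {set 'I_n} | #|S| == v)
    \sum_(m < n.+1 | S \subset [set i : 'I_n | (m <= i)%N]%SET)
      f v m * (p ^+ v * (1 - p) ^+ (n - v))).
  apply: eq_big => [S|S /andP[Schi /eqP <-]]; last by rewrite inordK.
  apply/andP/eqP => [[Schi /eqP <-]|Sv]; first by rewrite inordK.
  by rewrite Sv inord_val -ltnS ltn_ord eqxx.
rewrite (exchange_big_dep xpredT)//= mulr_sumr; apply: eq_bigr => m _.
rewrite sumr_const -[LHS]mulr_natr.
rewrite (_ : #|_| = 'C(n - m, v)); first by ring.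
rewrite -card_late_subsets ?leq_ord//; apply: eq_card => S.
by rewrite !inE andbC.
Qed.

(** The witness m is the number of points within [c #|S| * r]. Station n is at distance at least r,
    so every active station is beyond that radius and has index at least m. *)
Lemma SINR_ge_last_cell (R : realType) (d : measure_display) (T : measurableType d)
  (n : nat) (alpha Pw sigma2 gamma beta r r' : R) (x : nat -> T -> R * R)
  (a b : nat -> T -> bool) (w : T) :
  let c (v : nat) := (gamma / beta - (v%:R - 1)) `^ (- alpha^-1) in
  let S := [set i : 'I_n | a i w]%SET in
  0 < alpha -> 0 < Pw -> 0 <= sigma2 -> 0 < gamma -> 0 < beta -> 0 <= r ->
  (forall k, 0 < enorm2 (x k w)) -> (forall k, enorm2 (x k w) <= enorm2 (x k.+1 w)) ->
  SINR_ge n.+1 alpha Pw sigma2 (beta / gamma) x a b n w ->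
  cell x 0 r r' 0 n w ->
  #|S|%:R <= gamma / beta /\
  exists m : 'I_n.+1, S \subset [set i : 'I_n | (m <= i)%N]%SET /\
    cell x (c #|S| * r) r r' m n w.
Proof.
move=> c S alpha0 Pw0 sigma0 gamma0 beta0 r0 rho0 rhoS SINR cw.
have [|Sg far] := @path_loss_far R alpha (gamma / beta) n (fun k => enorm2 (x k w)) S alpha0 rho0 rhoS.
  rewrite (eq_bigl (fun i : 'I_n => a i w)); first exact: (SINR_ge_last Pw0 sigma0 gamma0 beta0 SINR).
  by move=> i; rewrite inE.
split => //.
have rn : r <= enorm2 (x n w) by have [_ + _] := cw n; rewrite ltnn leNgt => ->.
have c0 : 0 <= c #|S| by exact: powR_ge0.
have c1 : c #|S| <= 1.
  rewrite -[leRHS](powRr0 (gamma / beta - (#|S|%:R - 1))); apply: ler_powR; first by lra.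
  by rewrite oppr_le0 invr_ge0 ltW.
(* Station n lies beyond the inner radius, so the inner count is at most n. *)
have crn : c #|S| * r <= enorm2 (x n w).
  by apply: le_trans rn; rewrite ler_piMl.
have [N belowN] := nondecreasing_count rhoS (ex_intro _ n crn).
have Nn : (N < n.+1)%N.
  by rewrite ltnS leqNgt; apply/negP; rewrite -belowN ltNge crn.
exists (Ordinal Nn); split.
  apply/fintype.subsetP => i iS; rewrite inE /= leqNgt -belowN -leNgt.
  by apply: le_trans (far i iS); rewrite ler_wpM2l.
by move=> k; have [_ ? ?] := cw k.
Qed.

Unset Implicit Arguments.

Theorem theorem1 (R : realType) (d : measure_display) (T : measurableType d)
  (P : probability T R) (lam : R) (x : nat -> T -> R * R)
  (a b : nat -> T -> bool) (L : nat) (alpha Pw sigma2 gamma beta p q : R) :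
  0 < lam -> (1 <= L)%N -> 2 < alpha -> 0 < Pw -> 0 <= sigma2 ->
  0 < gamma -> 0 < beta -> 0 <= p <= 1 -> 0 <= q <= 1 ->
  is_ordered_hPPP P lam x ->
  marks_law P L p q x a b ->
  let chi := minn L.-1 (Num.truncn (gamma / beta)) in
  let fOmega (om : nat) : R := 'C(L.-1, om)%:R * p ^+ om * (1 - p) ^+ (L.-1 - om) in
  (P (\bigcap_(k in [set k : nat | (k < L)%N])
        SINR_ge L alpha Pw sigma2 (beta / gamma) x a b k)
   <= (\sum_(0 <= om < chi.+1)
         (1 - (gamma / beta - (om%:R - 1)) `^ (- (2 / alpha))) ^+ om
           * fOmega om)%:E)%E.
Proof.
move=> lam0 L1 alpha2 Pw0 sigma0 gamma0 beta0 /andP[p0 p1] _ hP.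
case: L L1 => // n _ hM; cbv zeta; rewrite [n.+1.-1]/=.
set chi := minn n _.
have [mx [xS _]] := hP; have [ma [mb _]] := hM.
have [kap kap0 kapE] := leb2_disc R.
have alpha0 : 0 < alpha by lra.
have g0 : 0 <= gamma / beta by rewrite divr_ge0// ltW.
have chiP v : (v <= chi)%N -> v%:R <= gamma / beta.
  by rewrite /chi leq_min => /andP[_]; rewrite truncn_ge_nat.
pose c (v : nat) := (gamma / beta - (v%:R - 1)) `^ (- alpha^-1).
have c0 v : 0 <= c v by exact: powR_ge0.
have c1 v : (v <= chi)%N -> c v <= 1.
  move=> /chiP vg; rewrite -[leRHS](powRr0 (gamma / beta - (v%:R - 1))); apply: ler_powR.
    by lra.
  by rewrite oppr_le0 invr_ge0 ltW.
have c2 v : (gamma / beta - (v%:R - 1)) `^ (- (2 / alpha)) = c v ^+ 2.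
  by rewrite -powR_mulrn ?c0// /c -powRrM mulNr [_^-1 * _]mulrC.
set B := \sum_(0 <= om < chi.+1) _.
have B0 : 0 <= B.
  rewrite /B big_mkord; apply: sumr_ge0 => v _; rewrite c2.
  have /c1 cv1 : (v <= chi)%N by rewrite -ltnS.
  by rewrite !mulr_ge0 ?exprn_ge0 ?subr_ge0 ?exprn_ile1.
set E := \bigcap_(k in _) _.
have mE : measurable E.
  by apply: bigcap_measurable => [|k _]; [exists 0%N|apply: measurable_SINR_ge => //; exact: ltW].
apply/lee_addgt0Pr => e e0.
have [eta eta0 [J SJ]] := pois_cells_sum_ge n e0.
(* Chosen so that lam kap rad(j)^2 = j eta: the disc has Poisson mean j eta and each annulus has
   mean eta. *)
pose rad (j : nat) := Num.sqrt (j%:R * eta / (lam * kap)).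
have lk0 : 0 < lam * kap by rewrite mulr_gt0.
have rad0 j : 0 <= rad j by exact: sqrtr_ge0.
have rad2 j : rad j ^+ 2 = j%:R * eta / (lam * kap).
  by rewrite sqr_sqrtr// !mulr_ge0 ?invr_ge0// ltW.
have rad_le i j : (i <= j)%N -> rad i <= rad j.
  by move=> ij; rewrite ler_wsqrtr// ler_pM2r ?invr_gt0// ler_pM2r// ler_nat.
have pcell j m (t : R) : 0 <= t <= 1 -> (m <= n)%N ->
  P (cell x (t * rad j) (rad j) (rad j.+1) m n) =
  (pois_pmf (j%:R * eta * t ^+ 2) m * pois_pmf (j%:R * eta * (1 - t ^+ 2)) (n - m)
   * pois_pmf eta 1)%:E.
  move=> /andP[t0 t1] mn.
  rewrite (probability_cell hP kapE) ?mulr_ge0 ?ler_piMl ?rad_le//.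
  rewrite exprMn !rad2 -natr1; congr (pois_pmf _ _ * pois_pmf _ _ * pois_pmf _ _)%:E;
    by field; rewrite !gt_eqF.
(* Inner radius 0 with inner count 0 is a vacuous condition; what remains is n points in disc j and
   exactly one in the next annulus. *)
pose main (j : 'I_J) := cell x 0 (rad j) (rad j.+1) 0 n.
have mmain j : measurable (main j) by exact: measurable_cell.
pose M := \big[setU/set0]_(j < J) main j.
have mM : measurable M by exact: bigsetU_measurable.
pose pi_ (j : nat) := pois_pmf (j%:R * eta) n * pois_pmf eta 1.
have Pmain j : P (main j) = (pi_ j)%:E.
  have := pcell j 0%N 0; rewrite lexx ler01 mul0r => -> //.
  by rewrite expr0n mulr0 subr0 mulr1 subn0 /pi_ {1}/pois_pmf expr0 oppr0 expR0 divr1 !mul1r.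
have PM : P M = (\sum_(j < J) pi_ j)%:E.
  rewrite /M measure_bigsetU_ord//; first by rewrite -sumEFin; apply: eq_bigr => j _; exact: Pmain.
  (* Point n cannot lie in two different annuli, so the main cells are disjoint. *)
  have main_lt (i j : 'I_J) w : (i < j)%N -> main i w -> main j w -> False.
    move=> ij /(_ n)[_ _]; rewrite ltnSn => xi /(_ n)[_ + _]; rewrite ltnn.
    by rewrite (lt_le_trans xi) ?rad_le.
  apply/trivIsetP => i j _ _ ij; apply/seteqP; split=> // w [wi wj].
  move: ij; rewrite -val_eqE neq_ltn => /orP[lt|lt].
    exact: main_lt lt wi wj.
  exact: main_lt lt wj wi.
have [mZ PZ] := probability_point_at_origin hP.
set Z := [set w | _] in mZ PZ.
pose late (m : nat) := [set i : 'I_n | (m <= i)%N]%SET.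
(* The index records the annulus of station n, the set of active nearer stations, and the number of
   points within the exclusion radius. *)
pose U (i : 'I_J * {set 'I_n} * 'I_n.+1) :=
  cell x (c #|i.1.2| * rad i.1.1) (rad i.1.1) (rad i.1.1.+1) i.2 n `&`
  [set w | forall k : 'I_n, a k w = (k \in i.1.2)].
pose Q (i : 'I_J * {set 'I_n} * 'I_n.+1) :=
  (#|i.1.2| <= chi)%N && (i.1.2 \subset late i.2).
have mU i : measurable (U i).
  apply: measurableI; first exact: measurable_cell.
  rewrite [X in measurable X](_ : _ = \bigcap_(k : 'I_n) [set w | a k w = (k \in i.1.2)]).
    apply: fin_bigcap_measurable => // k _; case: (k \in i.1.2); first exact: ma.
    rewrite [X in measurable X](_ : _ = ~` [set w | a k w]); first exact: measurableC.
    by apply/seteqP; split=> w /= => [->//|/negP/negbTE].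
  by apply/seteqP; split=> w aw k; [move=> _; exact: aw|exact: (aw k I)].
(* Off the null event and the complement of M, the constraint of station n alone places the outcome
   in some [U i] with [Q i]. *)
have E_sub : E `<=` Z `|` ~` M `|` \big[setU/set0]_(i | Q i) U i.
  move=> w Ew; have [Zw|nZ] := pselect (Z w); first by left; left.
  have [Mw|nM] := pselect (M w); last by left; right.
  have /in_bigsetU[j _ jw] := Mw.
  have xpos k : 0 < enorm2 (x k w) by rewrite ltNge; apply/negP => xk0; apply: nZ; exists k.
  have [Sg [m [Sm mw]]] := SINR_ge_last_cell alpha0 Pw0 sigma0 gamma0 beta0 (rad0 j) xpos
    (xS^~ w) (Ew n (ltnSn n)) jw.
  right; apply/in_bigsetU; exists (j, [set i : 'I_n | a i w]%SET, m).
    by rewrite /Q/= Sm andbT leq_min truncn_ge_nat// Sg andbT (leq_trans (max_card _))// card_ord.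
  by split=> // k; rewrite inE.
pose weight (j v m : nat) := pois_pmf (j%:R * eta * c v ^+ 2) m *
  pois_pmf (j%:R * eta * (1 - c v ^+ 2)) (n - m) * pois_pmf eta 1.
(* Independence of the marks bounds each term; summing over S and then m gives, for each annulus, B
   times its Poisson weight through [pois_thinning]. *)
have PU : (\sum_(i | Q i) P (U i) <= (B * \sum_(j < J) pi_ j)%:E)%E.
  apply: (@le_trans _ _ (\sum_(i | Q i) (weight i.1.1 #|i.1.2| i.2 *
      (p ^+ #|i.1.2| * (1 - p) ^+ (n - #|i.1.2|)))%:E)%E).
    apply: lee_sum => -[[j S] m] /andP[/= Schi _]; have m_le_n : (m <= n)%N := ltn_ord m.
    apply: le_trans (probability_cell_marks S mx xS _ _ m_le_n hM) _.
    - by rewrite ler_piMl ?c1.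
    - exact: rad_le.
    by rewrite pcell ?c0 ?c1// prod_bern_pmf.
  rewrite sumEFin lee_fin.
  rewrite -(pair_big_dep (fun js : 'I_J * {set 'I_n} => (#|js.2| <= chi)%N)
    (fun js (m : 'I_n.+1) => js.2 \subset late m) (fun js (m : 'I_n.+1) => weight js.1 #|js.2| m *
      (p ^+ #|js.2| * (1 - p) ^+ (n - #|js.2|))))/=.
  rewrite -(pair_big_dep xpredT (fun (j : 'I_J) (S : {set 'I_n}) => (#|S| <= chi)%N)
    (fun (j : 'I_J) (S : {set 'I_n}) => \sum_(m < n.+1 | S \subset late m) weight j #|S| m *
      (p ^+ #|S| * (1 - p) ^+ (n - #|S|))))/=.
  rewrite mulr_sumr; apply: ler_sum => j _; rewrite (sum_late_subsets n chi p (weight j)).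
  rewrite /B big_mkord mulr_suml; apply: ler_sum => v _; rewrite c2.
  have -> : \sum_(m < n.+1) 'C(n - m, v)%:R * weight j v m =
      'C(n, v)%:R * (1 - c v ^+ 2) ^+ v * pi_ j.
    rewrite /pi_ mulrA -pois_thinning mulr_suml; apply: eq_bigr => m _.
    by rewrite /weight !mulrA.
  by rewrite le_eqVlt; apply/orP; left; apply/eqP; ring.
have mUU : measurable (\big[setU/set0]_(i | Q i) U i) by exact: bigsetU_measurable.
apply: (@le_trans _ _ (P (Z `|` ~` M `|` \big[setU/set0]_(i | Q i) U i))).
  apply: le_measure; rewrite ?inE//; apply: measurableU => //.
  by apply: measurableU => //; exact: measurableC.
apply: (@le_trans _ _ (P (Z `|` ~` M) + P (\big[setU/set0]_(i | Q i) U i))%E).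
  by apply: measureU2 => //; apply: measurableU => //; exact: measurableC.
(* The complement of M has mass at most e by the choice of eta and J, and the Poisson weights sum to
   P(M) <= 1, so the total is at most B + e. *)
apply: (@le_trans _ _ ((1 - \sum_(j < J) pi_ j)%:E + (B * \sum_(j < J) pi_ j)%:E)%E).
  apply: leeD; last exact: le_trans (le_probability_bigsetU P Q mU) PU.
  apply: (@le_trans _ _ (P Z + P (~` M))%E); first by apply: measureU2 => //; exact: measurableC.
  by rewrite PZ add0e probability_setC// PM.
have S1 : \sum_(j < J) pi_ j <= 1 by rewrite -lee_fin -PM probability_le1.
have := ler_wpM2l B0 S1; rewrite -!EFinD lee_fin; lra.
Qed.
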